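(* Let $(\varsigma_n)_{n\ge1}\subset[0,\infty)$ be such that $\varsigma_n/n\to\infty$. Let $g_n(x,y):=e^{nx+(-1)^n\varsigma_ny}$ for $(x,y)\in\mathbb{R}^2$ and $g:=\sum_{n\ge1}g_n:\mathbb{R}^2\to[0,\infty]$. Then $\operatorname{dom}g^*=[0,\infty)\times\mathbb{R}$ and $$g^*(u,v)=\inf\Big\{\sum_{n\ge1}\gamma_n(\ln\gamma_n-1)\ \Big|\ \gamma_n\ge0\ (n\geq 1),\ u=\sum_{n\ge1}n\gamma_n,\ v=\sum_{n\ge1}(-1)^n\varsigma_n\gamma_n\Big\}\qquad(\ast)$$ for all $(u,v)\in\big((0,\infty)\times\mathbb{R}\big)\cup\{(0,0)\}$, while for $u=0\ne v$ the right-hand side of $(\ast)$ is $\infty$. Moreover, for $u=0=v$ the infimum in $(\ast)$ is attained, while for $u\in(0,\infty)$ the infimum in $(\ast)$ is attained if and only if $$\overline{v}:=\sum_{n\ge1}(-1)^n\varsigma_n\left(\frac{1+2u-\sqrt{4u+1}}{2u}\right)^n\in\mathbb{R}$$ (i.e. this series converges in $\mathbb{R}$) and $v=\overline{v}$.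
   Context: $g(x,y)=\sum_{n\ge1}g_n(x,y)$ is the limit in $[0,\infty]$ of the partial sums. The conjugate is $g^*(u,v)=\sup_{(x,y)\in\mathbb{R}^2}(xu+yv-g(x,y))$ and $\operatorname{dom}g^*=\{(u,v):g^*(u,v)<\infty\}$. Infinite sums are limits of partial sums (the constraint $v=\sum_{n\ge1}(-1)^n\varsigma_n\gamma_n$ requires convergence of partial sums to $v$; the objective is a limit in $(-\infty,\infty]$). Conventions: $0\cdot\ln0:=0$ and $\inf\emptyset:=\infty$. *)

(* Defs.v *)
From HB Require Import structures.
From mathcomp Require Import all_boot all_order all_algebra.
From mathcomp Require Import all_classical all_reals all_analysis.

Set Implicit Arguments.
Unset Strict Implicit.
Unset Printing Implicit Defensive.

Import Order.TTheory GRing.Theory Num.Theory.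
Import numFieldNormedType.Exports.

Local Open Scope classical_set_scope.
Local Open Scope ring_scope.

Definition conjugate (R : realType) (f : R * R -> \bar R) (p : R * R) : \bar R :=
  ereal_sup [set ((z.1 * p.1 + z.2 * p.2)%:E - f z)%E | z in [set: R * R]].

Definition edom (R : realType) (f : R * R -> \bar R) : set (R * R) :=
  [set p | (f p < +oo)%E].

(* Sequences indexed by n >= 1 are functions on nat whose value at 0 is never
   used. *)

Definition gterm (R : realType) (s : nat -> R) (n : nat) (z : R * R) : R :=
  expR (n%:R * z.1 + (-1) ^+ n * s n * z.2).

Definition g (R : realType) (s : nat -> R) (z : R * R) : \bar R :=
  (\sum_(1 <= n <oo) (gterm s n z)%:E)%E.

Definition feasible (R : realType) (s : nat -> R) (u v : R) : set (nat -> R) :=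
  [set c | [/\ forall n, (1 <= n)%N -> 0 <= c n,
               (fun N => \sum_(1 <= n < N) n%:R * c n) @ \oo --> u
             & (fun N => \sum_(1 <= n < N) (-1) ^+ n * s n * c n) @ \oo --> v]].

(* A limit in the extended reals.  It exists for every feasible c: only
   finitely many terms are positive, and the negative parts are summable since
   sum_n n * c n converges.  When c n = 0 the term is 0 (here ln 0 = 0). *)
Definition entropy (R : realType) (c : nat -> R) : \bar R :=
  (\sum_(1 <= n <oo) (c n * (ln (c n) - 1))%:E)%E.

(* ereal_inf set0 = +oo *)
Definition infval (R : realType) (s : nat -> R) (u v : R) : \bar R :=
  ereal_inf [set entropy c | c in feasible s u v].

Definition inf_attained (R : realType) (s : nat -> R) (u v : R) : Prop :=
  exists2 c, feasible s u v c & entropy c = infval s u v.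

Definition vbar_partial (R : realType) (s : nat -> R) (u : R) (N : nat) : R :=
  \sum_(1 <= n < N)
    (-1) ^+ n * s n * ((1 + 2 * u - Num.sqrt (4 * u + 1)) / (2 * u)) ^+ n.

(* The sum of the series only when cvgn (vbar_partial s u). *)
Definition vbar (R : realType) (s : nat -> R) (u : R) : R :=
  limn (vbar_partial s u).

(* Main.v *)
(** For [y <> 0] one parity class of the terms of [g (x, y)] blows up, so [g] is
finite exactly at the points [(x, 0)] with [x < 0], where with [q = expR x]
it is [q / (1 - q)].  Hence the conjugate does not depend on [v].

Fenchel's inequality [c * y <= c * (ln c - 1) + expR y], an equality iff
[c = expR y], applied termwise with [y = n * x], shows that the entropy of a
feasible [c] is [x * u - q / (1 - q)] plus a series of nonnegative gaps.  This
gives weak duality.  When [u = q / (1 - q) ^+ 2], i.e. when [x] is optimal, it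
also shows that the only possible minimizer is [c n = q ^+ n].

That sequence need not satisfy the constraint on [v], but its truncations can be
repaired: as [s n / n] tends to infinity, small masses at one large even and one
large odd index fix [u] and [v] exactly, and masses at most [1] contribute
nonpositively to the entropy. *)

Require Import Defs.
From HB Require Import structures.
From mathcomp Require Import all_boot all_order all_algebra ring lra zify.
From mathcomp Require Import all_classical all_reals all_analysis.

Import Order.TTheory GRing.Theory Num.Theory.
Import numFieldNormedType.Exports.

Local Open Scope classical_set_scope.
Local Open Scope ring_scope.

(** * Divergent and geometric series *)

Lemma nneseries_often_ge1 (R : realType) (a : nat -> R) :
  (forall n, 0 <= a n) -> (forall N, exists2 n, (N <= n)%N & 1 <= a n) ->
  (\sum_(1 <= n <oo) (a n)%:E = +oo)%E.
Proof.
move=> a_ge0 a_often; apply/eqyP => A A_gt0.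
have partial m : exists2 k, (1 <= k)%N & m%:R <= \sum_(1 <= n < k) a n.
  elim: m => [|m [k k_ge1 IH]]; first by exists 1%N => //; rewrite big_geq.
  have [n kn an] := a_often k; exists n.+1 => //.
  rewrite big_nat_recr ?(leq_trans k_ge1)//= -natr1 lerD//.
  by rewrite (le_trans IH)// (big_cat_nat k_ge1 kn)/= lerDl sumr_ge0.
have [k _ Ak] := partial (Num.bound A).
apply: le_trans (nneseries_lim_ge k _); last by move=> n _ _; rewrite lee_fin.
by rewrite sumEFin lee_fin (le_trans _ Ak)// ltW// archi_boundP// ltW.
Qed.

Lemma sum_expr (R : realType) (q : R) N : q != 1 ->
  \sum_(1 <= n < N.+1) q ^+ n = q / (1 - q) - q ^+ N.+1 / (1 - q).
Proof.
move=> q1; have q1' : 1 - q != 0 by rewrite subr_eq0 eq_sym.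
elim: N => [|N IH]; first by rewrite big_geq// expr1 subrr.
by rewrite big_nat_recr//= IH [q ^+ N.+2]exprS; field.
Qed.

Lemma sum_nat_expr (R : realType) (q : R) N : q != 1 ->
  \sum_(1 <= n < N.+1) n%:R * q ^+ n =
  q / (1 - q) ^+ 2 - q ^+ N.+1 * (1 + N%:R * (1 - q)) / (1 - q) ^+ 2.
Proof.
move=> q1; have q1' : 1 - q != 0 by rewrite subr_eq0 eq_sym.
elim: N => [|N IH]; first by rewrite big_geq// expr1 mul0r addr0 mulr1 subrr.
by rewrite big_nat_recr//= IH [q ^+ N.+2]exprS -natr1; field.
Qed.

(** Put [r = sqrt q] and split [n q^n] as [(n r^n) r^n]. The first factor is bounded by a geometric
    sum, since [r^n <= r^i] for [i < n], and the second tends to 0. *)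
Lemma cvg_natM_expr (R : realType) (q : R) : 0 <= q < 1 ->
  (fun n => n%:R * q ^+ n) @ \oo --> (0 : R).
Proof.
move=> /andP[q_ge0 q_lt1].
have r_ge0 : 0 <= Num.sqrt q by exact: sqrtr_ge0.
have r_lt1 : Num.sqrt q < 1 by rewrite -sqrtr1 ltr_sqrt.
have rE : q = Num.sqrt q ^+ 2 by rewrite sqr_sqrtr.
move: (Num.sqrt q) r_ge0 r_lt1 rE => r r_ge0 r_lt1 ->.
have bound n : n%:R * r ^+ n <= (1 - r)^-1.
  have : \sum_(0 <= i < n) r ^+ n <= \sum_(0 <= i < n) r ^+ i.
    rewrite !big_mkord; apply: ler_sum => i _.
    by rewrite ler_wiXn2l ?(ltW r_lt1)// ltnW.
  rewrite sumr_const_nat subn0 -[in X in X -> _]mulr_natl => h.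
  apply: (le_trans h); rewrite -[leRHS]mul1r ler_pdivlMr ?subr_gt0//.
  rewrite mulrC -opprB mulNr big_mkord -subrX1 opprB.
  by rewrite lerBlDr lerDl exprn_ge0.
apply: (squeeze_cvgr (f := fun=> 0) (h := fun n => (1 - r)^-1 * r ^+ n)).
- near=> n; rewrite -exprM mulnC exprM expr2 mulrA mulr_ge0 ?exprn_ge0//=.
    by rewrite ler_wpM2r ?exprn_ge0.
  by rewrite mulr_ge0 ?exprn_ge0.
- exact: cvg_cst.
- rewrite -[X in _ --> X](mulr0 (1 - r)^-1); apply: cvgM; first exact: cvg_cst.
  by apply: cvg_expr; rewrite ger0_norm.
Unshelve. all: by end_near. Qed.

Lemma cvg_sum_expr (R : realType) (q : R) : 0 <= q < 1 ->
  (fun N => \sum_(1 <= n < N) q ^+ n) @ \oo --> q / (1 - q).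
Proof.
move=> /andP[q_ge0 q_lt1].
suff : (fun N => \sum_(1 <= n < N.+1) q ^+ n) @ \oo --> q / (1 - q).
  by rewrite (cvg_shiftS (fun N => \sum_(1 <= n < N) q ^+ n)).
rewrite (funext (fun N => sum_expr R q N (negbT (lt_eqF q_lt1)))).
rewrite -[X in _ --> X]subr0; apply: cvgB; first exact: cvg_cst.
rewrite -[X in _ --> X](mul0r (1 - q)^-1); apply: cvgM; last exact: cvg_cst.
by rewrite (cvg_shiftS (fun n => q ^+ n)); apply: cvg_expr; rewrite ger0_norm.
Qed.

Lemma cvg_sum_nat_expr (R : realType) (q : R) : 0 <= q < 1 ->
  (fun N => \sum_(1 <= n < N) n%:R * q ^+ n) @ \oo --> q / (1 - q) ^+ 2.
Proof.
move=> q01; have /andP[q_ge0 q_lt1] := q01.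
suff : (fun N => \sum_(1 <= n < N.+1) n%:R * q ^+ n) @ \oo --> q / (1 - q) ^+ 2.
  by rewrite (cvg_shiftS (fun N => \sum_(1 <= n < N) n%:R * q ^+ n)).
rewrite (funext (fun N => sum_nat_expr R q N (negbT (lt_eqF q_lt1)))).
rewrite -[X in _ --> X]subr0; apply: cvgB; first exact: cvg_cst.
rewrite -[X in _ --> X](mul0r ((1 - q) ^+ 2)^-1).
apply: cvgM; last exact: cvg_cst.
have -> : (fun n => q ^+ n.+1 * (1 + n%:R * (1 - q))) =
  (fun n => q * q ^+ n + q * (1 - q) * (n%:R * q ^+ n)).
  by apply/funext => n; rewrite exprS; ring.
rewrite -[X in _ --> X]addr0 -{2}(mulr0 (q * (1 - q))) -{1}(mulr0 q).
apply: cvgD; apply: cvgM; try exact: cvg_cst.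
  by apply: cvg_expr; rewrite ger0_norm.
exact: cvg_natM_expr.
Qed.

(** * Fenchel's inequality and the values of [g] *)

(** For [c > 0] the gap is [c (e^t - 1 - t)] with [t = y - ln c], which vanishes only at [t = 0].
    For [c = 0] it is [expR y], hence positive. *)
Lemma fenchel_entropy (R : realType) (c y : R) : 0 <= c ->
  c * y <= c * (ln c - 1) + expR y ?= iff (c == expR y).
Proof.
rewrite le_eqVlt => /predU1P[<-|c_gt0].
  rewrite !mul0r add0r; split; first exact: expR_ge0.
  by [].
have -> : c * (ln c - 1) + expR y =
    c * y + c * (expR (y - ln c) - (1 + (y - ln c))).
  by rewrite expRB lnK//; field; rewrite gt_eqF.
split; first by rewrite lerDl mulr_ge0 ?subr_ge0 ?expR_ge1Dx// ltW.
rewrite -[LHS](inj_eq (addrI (- (c * y)))) addNr addKr eq_sym mulf_eq0.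
rewrite gt_eqF//=; apply/idP/eqP => [|->]; last first.
  by rewrite expRK subrr expR0 addr0 subrr.
have [yc _|yc] := eqVneq (y - ln c) 0.
  by rewrite -[LHS]lnK//; move/subr0_eq: yc => ->.
by rewrite subr_eq0 => /eqP h; have := expR_gt1Dx yc; rewrite h ltxx.
Qed.

Lemma superlinear_parity (R : realType) (s : nat -> R) (A : R) (N : nat)
    (b : bool) : (fun n : nat => s n / n%:R) @ \oo --> +oo ->
  exists n, [/\ (N <= n)%N, (1 <= n)%N, odd n = b & A * n%:R <= s n].
Proof.
move=> /cvgryPge/(_ A)[M _ MA]; exists (b + (maxn N M).+1.*2)%N.
have n_gt0 : (0 < b + (maxn N M).+1.*2)%N by rewrite addnC.
split => //.
- by rewrite -addnn; lia.
- by rewrite oddD odd_double addbF; case: b {n_gt0}.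
- by rewrite -ler_pdivlMr ?ltr0n//; apply: MA => /=; rewrite -addnn; lia.
Qed.

(** If [y <> 0], take indices with [(-1)^n y = |y|] and [s n |y| >= n |x|]: the exponent is then
    nonnegative, so infinitely many terms are at least 1. *)
Lemma g_eq_pinfty (R : realType) (s : nat -> R) (x y : R) :
  (fun n : nat => s n / n%:R) @ \oo --> +oo ->
  (y != 0) || (0 <= x) -> g s (x, y) = +oo%E.
Proof.
move=> s_div xy; apply: nneseries_often_ge1 => [n|N]; first exact: expR_ge0.
have [y0|y_neq0] := eqVneq y 0.
  exists N => //; rewrite /gterm/= y0 mulr0 addr0.
  rewrite -[leLHS]expR0 ler_expR mulr_ge0//.
  by move: xy; rewrite y0 eqxx.
have [n [Nn n_gt0 odd_n sn]] :=
  superlinear_parity R s (`|x| / `|y|) N (y < 0) s_div.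
exists n => //; rewrite /gterm/= -[leLHS]expR0 ler_expR -signr_odd odd_n.
rewrite -mulrA mulrCA -normrEsign.
have : n%:R * `|x| <= s n * `|y|.
  by rewrite -ler_pdivrMr ?normr_gt0// -mulrA mulrC.
have := ler_norm (- x); rewrite normrN => Nx.
have := ler_wpM2l (ler0n R n) Nx; lra.
Qed.

Lemma g_neg (R : realType) (s : nat -> R) (x : R) : x < 0 ->
  g s (x, 0) = (expR x / (1 - expR x))%:E.
Proof.
move=> x_lt0; apply: cvg_lim => //.
rewrite (_ : (fun _ => _) = fun N => (\sum_(1 <= n < N) expR x ^+ n)%:E).
  apply: cvg_EFin; first exact: nearW.
  by apply: cvg_sum_expr; rewrite expR_ge0 expR_lt1.
apply/funext => N; rewrite sumEFin; congr _%:E; apply: eq_bigr => n _.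
by rewrite /gterm/= mulr0 addr0 expRM_natl.
Qed.

(** * Entropy gaps and weak duality *)

(** The slack in Fenchel's inequality for [c n] at [y = n x]; writing [expR (n x)] as a power makes
    its sum geometric. *)
Definition entropy_gap (R : realType) (x : R) (c : nat -> R) (n : nat) : R :=
  c n * (ln (c n) - 1) + expR x ^+ n - c n * (n%:R * x).

Lemma entropy_gap_ge0 (R : realType) (x : R) (c : nat -> R) (n : nat) :
  0 <= c n -> 0 <= entropy_gap R x c n.
Proof.
move=> c_ge0; rewrite subr_ge0 -expRM_natl.
exact: (fenchel_entropy R _ (n%:R * x) c_ge0).1.
Qed.

Lemma entropy_gap_eq0 (R : realType) (x : R) (c : nat -> R) (n : nat) :
  0 <= c n -> (entropy_gap R x c n == 0) = (c n == expR x ^+ n).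
Proof.
move=> c_ge0; rewrite subr_eq0 eq_sym -expRM_natl.
exact: (fenchel_entropy R _ (n%:R * x) c_ge0).2.
Qed.

(** The gaps are nonnegative and the remaining part converges by the constraint on [u]. Besides
    giving the value, this shows that the limit defining [entropy c] exists, which is needed to pass
    inequalities to it. *)
Lemma cvg_entropy (R : realType) (s : nat -> R) (u v x : R) (c : nat -> R) :
  feasible s u v c -> x < 0 ->
  (fun N => \sum_(1 <= n < N) (c n * (ln (c n) - 1))%:E)%E @ \oo -->
  (\sum_(1 <= n <oo) (entropy_gap R x c n)%:E
   + (x * u - expR x / (1 - expR x))%:E)%E.
Proof.
move=> [c_ge0 cu _] x_lt0.
have x01 : 0 <= expR x < 1 by rewrite expR_ge0 expR_lt1.
rewrite (_ : (fun _ => _) = fun N =>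
  (\sum_(1 <= n < N) (entropy_gap R x c n)%:E +
   (x * (\sum_(1 <= n < N) n%:R * c n)
    - \sum_(1 <= n < N) expR x ^+ n)%:E)%E); last first.
  apply/funext => N; rewrite !sumEFin -EFinD; congr _%:E.
  rewrite mulr_sumr -sumrB -big_split/=; apply: eq_bigr => n _.
  by rewrite /entropy_gap; ring.
apply: cvgeD; first exact: fin_num_adde_defl.
  by apply: is_cvg_nneseries => n n1 _; rewrite lee_fin entropy_gap_ge0// c_ge0.
apply: cvg_EFin; first exact: nearW.
apply: cvgB; first by apply: cvgM => //; exact: cvg_cst.
exact: cvg_sum_expr.
Qed.

Lemma entropyE (R : realType) (s : nat -> R) (u v x : R) (c : nat -> R) :
  feasible s u v c -> x < 0 ->
  entropy c = (\sum_(1 <= n <oo) (entropy_gap R x c n)%:E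
   + (x * u - expR x / (1 - expR x))%:E)%E.
Proof.
by move=> cuv x_lt0; apply: cvg_lim => //; exact: (cvg_entropy _ s u v).
Qed.

Lemma conjugate_le_infval (R : realType) (s : nat -> R) (u v : R) :
  (fun n : nat => s n / n%:R) @ \oo --> +oo ->
  (conjugate (g s) (u, v) <= infval s u v)%E.
Proof.
move=> s_div; apply: ge_ereal_sup => _ [[x y] _ <-]/=.
have [xy|] := boolP ((y != 0) || (0 <= x)).
  by rewrite g_eq_pinfty// leNye.
rewrite negb_or negbK -ltNge => /andP[/eqP-> x_lt0].
rewrite g_neg// mul0r addr0; apply: le_ereal_inf_tmp => _ [c cuv <-].
rewrite (entropyE _ _ _ _ _ _ cuv x_lt0) EFinB leeDr//.
have [c_ge0 _ _] := cuv; apply: nneseries_ge0 => n n1 _.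
by rewrite lee_fin entropy_gap_ge0// c_ge0.
Qed.

(** * Lower bounds for the conjugate and its domain *)

Lemma conjugate_ge (R : realType) (s : nat -> R) (u v x : R) : x < 0 ->
  ((x * u - expR x / (1 - expR x))%:E <= conjugate (g s) (u, v))%E.
Proof.
move=> x_lt0; apply: ereal_sup_ubound; exists (x, 0) => //=.
by rewrite g_neg// mul0r addr0.
Qed.

(** Rearranges [1 - x <= expR (- x)]. It controls [g (x, 0)] as [x] tends to minus infinity. *)
Lemma expR_div_le (R : realType) (x : R) : x < 0 ->
  expR x / (1 - expR x) <= (- x)^-1.
Proof.
move=> x_lt0; have x_lt1 : 0 < 1 - expR x by rewrite subr_gt0 expR_lt1.
rewrite ler_pdivrMr// mulrC ler_pdivlMr ?oppr_gt0//.
have := expR_ge1Dx (- x); rewrite expRN -[X in _ <= X]div1r.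
by rewrite ler_pdivlMr ?expR_gt0//; lra.
Qed.

Lemma edom_conjugate (R : realType) (s : nat -> R) :
  (fun n : nat => s n / n%:R) @ \oo --> +oo ->
  edom (conjugate (g s)) = [set p | 0 <= p.1].
Proof.
move=> s_div; apply/seteqP; split => -[u v]/=; rewrite /edom/=.
  apply: contraPT; rewrite -ltNge => u_lt0; apply/negP; rewrite -leNgt leye_eq.
  apply/eqP/eqyP => A A_gt0.
  (* Here [x u = A + 1 - u], and [x < -1] bounds [g (x, 0)] by 1, so the value at [(x, 0)] is at
     least [A - u > A]. *)
  pose x := (A + 1) / u - 1.
  have q_lt0 : (A + 1) / u < 0 by rewrite pmulr_rlt0 ?invr_lt0//; lra.
  have x_lt0 : x < 0 by rewrite /x; lra.
  apply: le_trans (conjugate_ge R s u v x x_lt0); rewrite lee_fin.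
  have := expR_div_le R x x_lt0.
  have : (- x)^-1 <= 1 by rewrite invf_le1 /x; lra.
  have : x * u = A + 1 - u by rewrite /x mulrBl mul1r divfK ?lt_eqF.
  lra.
move=> u_ge0; apply: le_lt_trans (ltry 0).
apply: ge_ereal_sup => _ [[x y] _ <-]/=.
have [xy|] := boolP ((y != 0) || (0 <= x)).
  by rewrite g_eq_pinfty// leNye.
rewrite negb_or negbK -ltNge => /andP[/eqP-> x_lt0].
rewrite g_neg// mul0r addr0 lee_fin subr_le0.
apply: (@le_trans _ _ 0); first by rewrite mulr_le0_ge0// ltW.
by rewrite divr_ge0 ?expR_ge0// subr_ge0 expR_le1 ltW.
Qed.

(** * Feasible sequences and repair of truncations *)

Lemma feasible0 (R : realType) (s : nat -> R) (v : R) (c : nat -> R) :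
  feasible s 0 v c -> forall n, (1 <= n)%N -> c n = 0.
Proof.
move=> [c_ge0 c0 _] n n1; apply/eqP; rewrite eq_le c_ge0// andbT.
rewrite -(@pmulr_rle0 _ n%:R) ?ltr0n//.
apply: (cvgr_to_ge c0); exists n.+1 => // N /= nN.
rewrite (bigD1_seq n)/= ?iota_uniq ?mem_index_iota ?n1// lerDl.
rewrite big_nat_cond; apply: sumr_ge0 => m /andP[/andP[m1 _] _].
by rewrite mulr_ge0// c_ge0.
Qed.

Lemma sum_delta_nat (R : realType) (w : nat -> R) (a : R) (k M : nat) :
  (1 <= k < M)%N -> \sum_(1 <= n < M) w n * (a *+ (n == k)) = w k * a.
Proof.
move=> kM; under eq_bigr do rewrite mulrnAr mulrb.
by rewrite -big_mkcond big_nat1_eq kM.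
Qed.

Lemma sum_truncated_nat (R : realType) (w p : nat -> R) (N M : nat) :
  (1 <= N <= M)%N ->
  \sum_(1 <= n < M) w n * (if (n < N)%N then p n else 0) =
  \sum_(1 <= n < N) w n * p n.
Proof.
move=> /andP[N1 NM]; rewrite (big_cat_nat N1 NM)/=.
rewrite [X in _ + X]big_nat_cond [X in _ + X]big1 ?addr0 => [|n]; last first.
  by rewrite andbT => /andP[Nn _]; rewrite ltnNge Nn mulr0.
rewrite big_nat_cond [RHS]big_nat_cond.
by apply: eq_bigr => n /andP[/andP[_ ->]].
Qed.

(** Masses [a] at an even and [b] at an odd index past [N] absorb the residuals [e] in [u] and [d]
    in [v]; [e > 0] allows any [d]. The bound [e <= 1] gives [a <= k a <= e <= 1], and likewise for
    [b]. *)
Lemma feasible_completion (R : realType) (s p : nat -> R) (u v : R) (N : nat) :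
  (fun n : nat => s n / n%:R) @ \oo --> +oo ->
  (forall n, 0 <= p n) -> (1 <= N)%N ->
  0 < u - \sum_(1 <= n < N) n%:R * p n <= 1 ->
  exists c, [/\ feasible s u v c, forall n, (n < N)%N -> c n = p n &
    forall n, (N <= n)%N -> c n <= 1].
Proof.
move=> s_div p_ge0 N1; set e := u - _ => /andP[e_gt0 e_le1].
pose d := v - \sum_(1 <= n < N) (-1) ^+ n * s n * p n.
(* The summand [|d| / e] will make both masses nonnegative; the extra 1 makes [s k] and [s l]
   positive, hence [D > 0]. *)
have [k [Nk k1 k_even sk]] :=
  superlinear_parity R s (`|d| / e + 1) N false s_div.
have [l [Nl l1 l_odd sl]] :=
  superlinear_parity R s (`|d| / e + 1) N true s_div.
have kR1 : 1 <= k%:R :> R by rewrite ler1n.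
have lR1 : 1 <= l%:R :> R by rewrite ler1n.
have dk : `|d| * k%:R <= e * s k.
  rewrite -ler_pdivrMl// mulrA [e^-1 * _]mulrC (le_trans _ sk)// mulrDl; lra.
have dl : `|d| * l%:R <= e * s l.
  rewrite -ler_pdivrMl// mulrA [e^-1 * _]mulrC (le_trans _ sl)// mulrDl; lra.
have de_ge0 : 0 <= `|d| / e by rewrite divr_ge0// ltW.
have sk_gt0 : 0 < s k.
  by apply: lt_le_trans sk; apply: mulr_gt0; lra.
have sl_gt0 : 0 < s l.
  by apply: lt_le_trans sl; apply: mulr_gt0; lra.
pose D := k%:R * s l + l%:R * s k.
have D_gt0 : 0 < D by apply: addr_gt0; apply: mulr_gt0 => //; lra.
have d_k : - (e * s k) <= d * k%:R <= e * s k.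
  by rewrite -ler_norml normrM normr_nat.
have d_l : - (e * s l) <= d * l%:R <= e * s l.
  by rewrite -ler_norml normrM normr_nat.
(* [a] and [b] solve [k a + l b = e], [s k a - s l b = d]; they are nonnegative
   since [|d| / e] is at most [s k / k] and [s l / l]. *)
pose a := (d * l%:R + e * s l) / D.
pose b := (e * s k - d * k%:R) / D.
have a_ge0 : 0 <= a by rewrite divr_ge0 ?(ltW D_gt0)//; lra.
have b_ge0 : 0 <= b by rewrite divr_ge0 ?(ltW D_gt0)//; lra.
have ab_u : k%:R * a + l%:R * b = e.
  by rewrite /a /b /D; field; exact: lt0r_neq0.
have ab_v : s k * a - s l * b = d.
  by rewrite /a /b /D; field; exact: lt0r_neq0.
have ka : a <= k%:R * a by rewrite ler_peMl.
have lb : b <= l%:R * b by rewrite ler_peMl.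
have kl : k != l by apply/eqP => kl; move: l_odd; rewrite -kl k_even.
pose c n := (if (n < N)%N then p n else 0) + a *+ (n == k) + b *+ (n == l).
(* The weight [w] is left general to serve both constraints: [n] for [u] and [(-1)^n s n] for
   [v]. *)
have c_sum w M : (maxn k l < M)%N -> \sum_(1 <= n < M) w n * c n =
    \sum_(1 <= n < N) w n * p n + w k * a + w l * b.
  rewrite gtn_max => /andP[kM lM].
  under eq_bigr do rewrite /c 2!mulrDr.
  rewrite 2!big_split/= sum_truncated_nat ?N1 ?(leq_trans Nk) 1?ltnW//.
  by rewrite !sum_delta_nat ?k1 ?l1.
have c_cvg w : (fun M => \sum_(1 <= n < M) w n * c n) @ \oo -->
    \sum_(1 <= n < N) w n * p n + w k * a + w l * b.
  by apply: cvg_near_cst; exists (maxn k l).+1 => // M /= /c_sum ->.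
exists c; split.
- split.
  + move=> n _; rewrite /c !addr_ge0 ?mulrn_wge0//.
    by case: ifP.
  + have := c_cvg (fun n => n%:R); rewrite -addrA ab_u.
    by rewrite /e addrC subrK.
  + have := c_cvg (fun n => (-1) ^+ n * s n).
    rewrite -(signr_odd _ k) -(signr_odd _ l) k_even l_odd expr0 expr1 mul1r.
    by rewrite mulN1r mulNr -addrA ab_v /d addrC subrK.
- move=> n nN; rewrite /c nN !ltn_eqF ?mulr0n ?addr0//.
    exact: leq_trans Nl.
  exact: leq_trans Nk.
- move=> n Nn; rewrite /c ltnNge Nn/= add0r.
  case: (eqVneq n k) => [->|_]; first by rewrite (negbTE kl) addr0 mulr1n; lra.
  by case: (n == l); rewrite ?mulr1n ?mulr0n; lra.
Qed.

(** * Upper bound for the infimum and strong duality *)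

Lemma entropy_le_partial (R : realType) (s : nat -> R) (u v : R) (N : nat)
    (c : nat -> R) : feasible s u v c -> (1 <= N)%N ->
  (forall n, (N <= n)%N -> c n <= 1) ->
  (entropy c <= (\sum_(1 <= n < N) c n * (ln (c n) - 1))%:E)%E.
Proof.
move=> cuv N1 c_le1.
(* Any negative [x] would do: it only yields convergence of the entropy series. *)
have N1_lt0 : -1 < 0 :> R by rewrite ltrN10.
apply: lime_le.
  exact: (cvgP _ (cvg_entropy _ _ _ _ _ _ cuv N1_lt0)).
exists N => // M /= NM; rewrite sumEFin lee_fin (big_cat_nat N1 NM)/=.
rewrite gerDl big_nat_cond; apply: sumr_le0 => n; rewrite andbT => /andP[Nn _].
have [c_ge0 _ _] := cuv.
rewrite mulr_ge0_le0 ?c_ge0 ?(leq_trans N1)//.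
by have := ln_le0 (c_le1 _ Nn); lra.
Qed.

(** Completing the truncation of [expR x ^+ n] at [N] costs no entropy, so the infimum is below the
    [N]-th partial entropy sum of that sequence for all large [N]; these sums tend to the bound. *)
Lemma infval_le (R : realType) (s : nat -> R) (u v x : R) :
  (fun n : nat => s n / n%:R) @ \oo --> +oo -> x < 0 ->
  u = expR x / (1 - expR x) ^+ 2 ->
  (infval s u v <= (x * u - expR x / (1 - expR x))%:E)%E.
Proof.
move=> s_div x_lt0 uE.
have x01 : 0 <= expR x < 1 by rewrite expR_ge0 expR_lt1.
have /andP[_ x_lt1] := x01.
have cvg_u := cvg_sum_nat_expr R _ x01; rewrite -uE in cvg_u.
have cvg_S : (fun N => (\sum_(1 <= n < N)
    expR x ^+ n * (ln (expR x ^+ n) - 1))%:E) @ \oo -->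
    (x * u - expR x / (1 - expR x))%:E.
  rewrite (_ : (fun _ => _) = fun N =>
    (x * (\sum_(1 <= n < N) n%:R * expR x ^+ n)
     - \sum_(1 <= n < N) expR x ^+ n)%:E).
    apply: cvg_EFin; first exact: nearW.
    apply: cvgB; first by apply: cvgM => //; exact: cvg_cst.
    exact: cvg_sum_expr.
  apply/funext => N; congr _%:E; rewrite mulr_sumr -sumrB.
  apply: eq_bigr => n _; rewrite lnXn ?expR_gt0// expRK -mulr_natl; ring.
rewrite -(cvg_lim _ cvg_S)//; apply: lime_ge; first exact: cvgP cvg_S.
have near_u : \forall N \near \oo, u - 1 < \sum_(1 <= n < N) n%:R * expR x ^+ n.
  by apply: (cvgr_gt _ cvg_u); rewrite ltrBlDr ltrDl.
near=> N.
have N1 : (1 <= N)%N by near: N; exact: nbhs_infty_ge.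
have eN : 0 < u - \sum_(1 <= n < N) n%:R * expR x ^+ n <= 1.
  apply/andP; split; last first.
    by rewrite lerBlDr addrC -lerBlDr ltW//; near: N.
  (* The residual is positive because the closed form of the partial sum gives the tail
     explicitly. *)
  rewrite -(prednK N1); move: N.-1 => m.
  rewrite sum_nat_expr ?lt_eqF// -uE opprB addrC subrK.
  rewrite divr_gt0 ?exprn_gt0 ?subr_gt0// mulr_gt0 ?exprn_gt0 ?expR_gt0//.
  by rewrite ltr_pwDl// mulr_ge0// subr_ge0 ltW.
have [|c [cuv cp c_le1]] :=
  feasible_completion R s (fun n => expR x ^+ n) u v N s_div _ N1 eN.
  by move=> n; rewrite exprn_ge0// expR_ge0.
have infval_c : (infval s u v <= entropy c)%E.
  by apply: ereal_inf_lbound; exists c.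
apply: (le_trans infval_c).
apply: (le_trans (entropy_le_partial R s u v N c cuv N1 c_le1)).
rewrite lee_fin big_nat_cond [leRHS]big_nat_cond le_eqVlt; apply/orP; left.
by apply/eqP/eq_bigr => n /andP[/andP[_ nN] _]; rewrite cp.
Unshelve. all: by end_near. Qed.

(** This [q] is the root in [(0, 1)] of [u (1 - q)^2 = q]. With [r = sqrt (4 u + 1)] one has
    [1 - q = (r - 1) / (2 u)] and [q = (r - 1)^2 / (4 u)]. *)
Lemma geometric_ratio (R : realType) (u : R) : 0 < u ->
  let q := (1 + 2 * u - Num.sqrt (4 * u + 1)) / (2 * u) in
  0 < q < 1 /\ u = q / (1 - q) ^+ 2.
Proof.
move=> u_gt0 /=; set r := Num.sqrt _.
have r2 : r ^+ 2 = 4 * u + 1 by rewrite sqr_sqrtr//; lra.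
have r_ge0 : 0 <= r by exact: sqrtr_ge0.
have r_gt1 : 1 < r by rewrite -(@ltr_pXn2r _ 2) ?nnegrE// r2; lra.
have r_lt : r < 1 + 2 * u.
  rewrite -(@ltr_pXn2r _ 2) ?nnegrE//; last lra.
  by rewrite r2; have := mulr_gt0 u_gt0 u_gt0; lra.
split.
  rewrite divr_gt0/= ?subr_gt0//; last lra.
  by rewrite ltr_pdivrMr; lra.
have -> : 1 - (1 + 2 * u - r) / (2 * u) = (r - 1) / (2 * u).
  by field; rewrite gt_eqF//; lra.
have -> : (1 + 2 * u - r) = (r - 1) ^+ 2 / 2 by rewrite sqrrB r2; field.
by field; rewrite !gt_eqF//; lra.
Qed.

(** Three inequalities close a cycle: conjugate, infimum, dual value at [x], conjugate. *)
Lemma infvalE (R : realType) (s : nat -> R) (u v x : R) :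
  (fun n : nat => s n / n%:R) @ \oo --> +oo -> x < 0 ->
  u = expR x / (1 - expR x) ^+ 2 ->
  infval s u v = (x * u - expR x / (1 - expR x))%:E /\
  conjugate (g s) (u, v) = infval s u v.
Proof.
move=> s_div x_lt0 uE.
have upper := infval_le R s u v x s_div x_lt0 uE.
have lower := conjugate_ge R s u v x x_lt0.
have weak := conjugate_le_infval R s u v s_div.
split; apply: le_anti; first by rewrite upper (le_trans lower).
by rewrite weak (le_trans upper).
Qed.

(** * Attainment, the origin and the conclusion *)

Lemma nneseries_eq0_term (R : realType) (a : nat -> R) :
  (forall n, (1 <= n)%N -> 0 <= a n) -> (\sum_(1 <= n <oo) (a n)%:E = 0)%E ->
  forall n, (1 <= n)%N -> a n = 0.
Proof.
move=> a_ge0 a_sum n n1; apply/eqP; rewrite eq_le a_ge0// andbT.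
have : ((\sum_(1 <= i < n.+1) (a i)%:E) <= 0)%E.
  rewrite -[leRHS]a_sum; apply: nneseries_lim_ge => i i1 _.
  by rewrite lee_fin a_ge0.
rewrite sumEFin lee_fin big_nat_recr//=; apply: le_trans.
rewrite lerDr big_nat_cond sumr_ge0// => i /andP[/andP[i1 _] _].
exact: a_ge0.
Qed.

(** A feasible [c] is optimal iff its gap series is 0, that is, iff [c n = expR x ^+ n] for
    [n >= 1]. This sequence meets the constraint on [u], so only the one on [v] remains. *)
Lemma inf_attained_iff (R : realType) (s : nat -> R) (u v x : R) :
  (fun n : nat => s n / n%:R) @ \oo --> +oo -> x < 0 ->
  u = expR x / (1 - expR x) ^+ 2 ->
  inf_attained s u v <->
  (fun N => \sum_(1 <= n < N) (-1) ^+ n * s n * expR x ^+ n) @ \oo --> v.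
Proof.
move=> s_div x_lt0 uE; rewrite /inf_attained.
rewrite (infvalE R s u v x s_div x_lt0 uE).1; split.
  move=> [c cuv]; rewrite (entropyE _ _ _ _ _ _ cuv x_lt0) => gap0.
  have [c_ge0 _ cv] := cuv.
  have {}gap0 : (\sum_(1 <= n <oo) (entropy_gap R x c n)%:E = 0)%E.
    by rewrite -[LHS](@addeK _ (x * u - expR x / (1 - expR x))%:E)// gap0 subee.
  have gap_ge0 n : (1 <= n)%N -> 0 <= entropy_gap R x c n.
    by move=> n1; rewrite entropy_gap_ge0// c_ge0.
  rewrite (_ : (fun _ => _) =
    fun N => \sum_(1 <= n < N) (-1) ^+ n * s n * c n)//.
  apply/funext => N; rewrite big_nat_cond [RHS]big_nat_cond.
  apply: eq_bigr => n /andP[/andP[n1 _] _]; congr (_ * _); apply/esym/eqP.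
  rewrite -(entropy_gap_eq0 _ _ _ _ (c_ge0 n n1)).
  by rewrite (nneseries_eq0_term _ _ gap_ge0 gap0).
move=> xv; have c_ge0 n : 0 <= expR x ^+ n by rewrite exprn_ge0// expR_ge0.
have cuv : feasible s u v (fun n => expR x ^+ n).
  split=> //; rewrite uE; apply: cvg_sum_nat_expr.
  by rewrite expR_ge0 expR_lt1.
exists (fun n => expR x ^+ n) => //.
rewrite (entropyE _ _ _ _ _ _ cuv x_lt0) eseries0 ?add0e// => n _ _.
by congr _%:E; apply/eqP; rewrite entropy_gap_eq0.
Qed.

Lemma infval00 (R : realType) (s : nat -> R) :
  (fun n : nat => s n / n%:R) @ \oo --> +oo ->
  [/\ feasible s 0 0 (fun=> 0), entropy (fun=> 0 : R) = 0%E,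
      infval s 0 0 = 0%E & conjugate (g s) (0, 0) = 0%E].
Proof.
move=> s_div.
have zero_feas : feasible s 0 0 (fun=> 0).
  split=> //; under eq_fun do [under eq_bigr do rewrite mulr0; rewrite big1//].
    exact: cvg_cst.
  exact: cvg_cst.
have zero_entropy : entropy (fun=> 0 : R) = 0%E.
  by apply: eseries0 => n _ _; rewrite mul0r.
have weak := conjugate_le_infval R s 0 0 s_div.
have upper : (infval s 0 0 <= 0)%E.
  by rewrite -zero_entropy; apply: ereal_inf_lbound; exists (fun=> 0).
have lower : (0 <= conjugate (g s) (0%R, 0%R))%E.
  (* At [u = 0] no [x] is optimal: the value 0 is only approached as [x] tends to minus infinity.
     The choice [x = - e^-1] makes [g (x, 0) <= e]. *)
  apply/lee_subgt0Pr => e e_gt0; rewrite add0e -EFinN.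
  have x_lt0 : - e^-1 < 0 by rewrite oppr_lt0 invr_gt0.
  apply: le_trans (conjugate_ge R s 0 0 _ x_lt0).
  rewrite lee_fin mulr0 add0r lerN2 (le_trans (expR_div_le R _ x_lt0))//.
  by rewrite opprK invrK.
split => //; apply: le_anti.
  by rewrite upper (le_trans lower).
by rewrite lower (le_trans weak).
Qed.

Theorem proposition18 (R : realType) (s : nat -> R)
    (s_ge0 : forall n, (1 <= n)%N -> 0 <= s n)
    (s_div : (fun n : nat => s n / n%:R) @ \oo --> +oo) :
  [/\ edom (conjugate (g s)) = [set p | 0 <= p.1],
      forall u v : R, 0 < u \/ (u = 0 /\ v = 0) ->
        conjugate (g s) (u, v) = infval s u v,
      forall v : R, v <> 0 -> infval s 0 v = +oo%E,
      inf_attained s 0 0 &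
      forall u v : R, 0 < u ->
        (inf_attained s u v <-> cvgn (vbar_partial s u) /\ v = vbar s u)].
Proof.
have [zero_feas zero_entropy infval0 conjugate0] := infval00 R s s_div.
split.
- exact: edom_conjugate.
- move=> u v [u_gt0|[-> ->]]; last by rewrite conjugate0.
  have [/andP[q_gt0 q_lt1] uE] := geometric_ratio R u u_gt0.
  (* The optimal dual point is [x = ln q]. *)
  rewrite -(lnK q_gt0) in uE; apply: (infvalE R s u v _ s_div _ uE).2.
  by rewrite ln_lt0// q_gt0.
- move=> v v_neq0; rewrite /infval.
  (* With [u = 0] every [c n] with [n >= 1] vanishes, which forces [v = 0]. *)
  rewrite (_ : feasible s 0 v = set0) ?image_set0 ?ereal_inf0//.
  rewrite -subset0 => c cv; apply: v_neq0.
  have c0 := feasible0 R s v c cv; case: cv => _ _.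
  rewrite (_ : (fun _ => _) = fun=> 0) => [cv|].
    by apply: (cvg_unique _ cv) => //; exact: cvg_cst.
  apply/funext => N; rewrite big_nat_cond big1// => n /andP[/andP[n1 _] _].
  by rewrite c0// mulr0.
- by exists (fun=> 0) => //; rewrite zero_entropy.
- move=> u v u_gt0.
  have [/andP[q_gt0 q_lt1] uE] := geometric_ratio R u u_gt0.
  rewrite -(lnK q_gt0) in uE.
  have := inf_attained_iff R s u v _ s_div _ uE; rewrite lnK// => -> //.
    split => [cv|[cv ->]//]; split; first exact: cvgP cv.
    by apply/esym/cvg_lim.
  by rewrite ln_lt0// q_gt0.
Qed.
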